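(* Let $\lambda$ be a partition with at most $n$ parts and $\mu\in S_n(\lambda)$ with $|\mu|=d$. Then $f^*_\mu$ is the unique polynomial $g$ in $x_1,\dots,x_n$ of degree at most $d$ such that (i) $g(\widetilde\nu)=0$ for every $\nu\in\mathbb{N}^n$ with $|\nu|\le|\mu|$ and $\nu\notin S_n(\lambda)$, and (ii) for every $\tau\in S_n(\lambda)$, the coefficient of $x^\tau$ in $g$ equals $\delta_{\tau,\mu}$.
   Context: Polynomials are in $x_1,\dots,x_n$ over $\mathbb{Q}(q,t)$. For $\mu\in\mathbb{N}^n$ let $k_i(\mu)=\#\{j<i:\mu_j>\mu_i\}+\#\{j>i:\mu_j\ge\mu_i\}$ and $\widetilde\mu=(q^{\mu_1}t^{-k_1(\mu)},\dots,q^{\mu_n}t^{-k_n(\mu)})$. For $\mu\in\mathbb{N}^n$, $|\mu|=d$, $E^*_\mu$ is the unique polynomial of degree at most $d$ with coefficient of $x^\mu$ equal to $1$ and $E^*_\mu(\widetilde\nu)=0$ for all $\nu\in\mathbb{N}^n$, $|\nu|\le d$, $\nu\ne\mu$. $S_n$ acts on compositions by $\sigma\cdot\mu=(\mu_{\sigma^{-1}(1)},\dots,\mu_{\sigma^{-1}(n)})$ and on polynomials by permuting variables; $s_i=(i,i+1)$; $T_i=t-\frac{tx_i-x_{i+1}}{x_i-x_{i+1}}(1-s_i)$; $T_\sigma=T_{i_1}\cdots T_{i_\ell}$ for a reduced word. $S_n(\lambda)$ is the set of rearrangements of $\lambda$; for $\mu\in S_n(\lambda)$, $\sigma_\mu$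 is the shortest permutation with $\sigma_\mu(\lambda)=\mu$, and $f^*_\mu=T_{\sigma_\mu}E^*_\lambda$. *)

(* Defs.v *)
From HB Require Import structures.
From mathcomp Require Import all_boot all_order all_algebra all_fingroup.
From mathcomp Require Import fraction.
From mathcomp Require Import mpoly.
From Stdlib Require Import ClassicalEpsilon.

Set Implicit Arguments.
Unset Strict Implicit.
Unset Printing Implicit Defensive.
Import Order.TTheory GRing.Theory.
Local Open Scope ring_scope.

Definition Kqt : fieldType := {fraction {poly {poly rat}}}.
Definition qq : Kqt := tofrac (('X : {poly rat})%:P).
Definition tt : Kqt := tofrac ('X : {poly {poly rat}}).

(* Compositions mu in N^n are monomials 'X_{1..n}; |mu| = mdeg mu;
   "degree at most d" is  msize g <= d.+1  (msize = 1 + total degree). *)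

Definition kmu n (mu : 'X_{1..n}) (i : 'I_n) : nat :=
  (#|[set j : 'I_n | (j < i)%N && (mu i < mu j)%N]|
   + #|[set j : 'I_n | (i < j)%N && (mu i <= mu j)%N]|)%N.

Definition tilde n (mu : 'X_{1..n}) : 'I_n -> Kqt :=
  fun i => qq ^+ (mu i) / tt ^+ (kmu mu i).

Definition Estar_spec n (mu : 'X_{1..n}) (g : {mpoly Kqt[n]}) : Prop :=
  [/\ (msize g <= (mdeg mu).+1)%N, g@_mu = 1 &
      forall nu : 'X_{1..n}, (mdeg nu <= mdeg mu)%N -> nu <> mu ->
        g.@[tilde nu] = 0].

Definition Estar n (mu : 'X_{1..n}) : {mpoly Kqt[n]} :=
  epsilon (inhabits 0) (Estar_spec mu).

Definition sact n (s : 'S_n) (mu : 'X_{1..n}) : 'X_{1..n} :=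
  [multinom mu ((s^-1)%g i) | i < n].

Definition inSn n (lambda tau : 'X_{1..n}) : Prop :=
  exists s : 'S_n, tau = sact s lambda.

Definition is_partition n (lambda : 'X_{1..n}) : Prop :=
  forall i j : 'I_n, (i <= j)%N -> (lambda j <= lambda i)%N.

Definition valid_idx n (i : nat) : bool := (i.+1 < n)%N.

Definition sperm n (i : nat) : 'S_n :=
  match @idP (i.+1 < n)%N with
  | ReflectT h => tperm (Ordinal (ltnW h)) (Ordinal h)
  | ReflectF _ => 1%g
  end.

(* the permutation s_{i1} o ... o s_{il} of a word [:: i1; ...; il]
   (mathcomp: (a * b) x = b (a x)) *)
Definition wperm n (w : seq nat) : 'S_n :=
  foldr (fun i s => (s * sperm n i)%g) 1%g w.

Definition plen n (s : 'S_n) : nat :=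
  epsilon (inhabits 0%N) (fun l =>
    (exists w, all (@valid_idx n) w /\ wperm n w = s /\ size w = l) /\
    forall w, all (@valid_idx n) w -> wperm n w = s -> (l <= size w)%N).

Definition reduced_word n (s : 'S_n) (w : seq nat) : Prop :=
  [/\ all (@valid_idx n) w, wperm n w = s &
      forall w', all (@valid_idx n) w' -> wperm n w' = s -> (size w <= size w')%N].

(* Demazure-Lusztig operator T_i on the pair of variables a = x_i, b = x_{i+1}:
   T_i f = t f - (t x_i - x_{i+1})/(x_i - x_{i+1}) (f - s_i f),
   i.e. the polynomial g with (x_i - x_{i+1}) g = t (x_i - x_{i+1}) f
   - (t x_i - x_{i+1}) (f - s_i f). *)
Definition Tab n (a b : 'I_n) (f : {mpoly Kqt[n]}) : {mpoly Kqt[n]} :=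
  epsilon (inhabits 0) (fun g =>
    ('X_a - 'X_b) * g =
      tt *: (('X_a - 'X_b) * f) - (tt *: 'X_a - 'X_b) * (f - msym (tperm a b) f)).

Definition Ti n (i : nat) (f : {mpoly Kqt[n]}) : {mpoly Kqt[n]} :=
  match @idP (i.+1 < n)%N with
  | ReflectT h => Tab (Ordinal (ltnW h)) (Ordinal h) f
  | ReflectF _ => f
  end.

Definition Tperm n (s : 'S_n) (f : {mpoly Kqt[n]}) : {mpoly Kqt[n]} :=
  foldr (fun i g => Ti i g) f (epsilon (inhabits [::]) (reduced_word s)).

Definition sigma_of n (lambda mu : 'X_{1..n}) : 'S_n :=
  epsilon (inhabits 1%g) (fun s =>
    sact s lambda = mu /\
    forall s', sact s' lambda = mu -> (plen s <= plen s')%N).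

Definition fstar n (lambda mu : 'X_{1..n}) : {mpoly Kqt[n]} :=
  Tperm (sigma_of lambda mu) (Estar lambda).

(* Main.v *)
(* Write N(mu) for the sum of the mu_i^2 and inv(mu) for the number of pairs i < j
   with mu_i < mu_j. For every composition mu there is a polynomial E_mu of degree
   at most |mu| that vanishes at all points of degree at most |mu| except that of
   mu, where it is nonzero, has x^mu-coefficient 1, and whose other monomials x^nu
   of degree |mu| satisfy N(nu) < N(mu), or nu is a rearrangement of mu with
   inv(nu) < inv(mu). It is built recursively: at a descent mu_i > mu_{i+1} a
   combination T_i E_mu + c E_mu is E_{s_i mu}, and if a partition lambda has k
   nonzero parts, then lambda = Phi^k(eta) where
   Phi(nu) = (nu_n + 1, nu_1, ..., nu_{n-1}) and
   eta = (0, ..., 0, lambda_1 - 1, ..., lambda_k - 1), and the operator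
   g |-> (x_1 - t^(1-n)) g(x_2, ..., x_n, x_1 / q) sends E_nu to a multiple of
   E_{Phi nu}. Since N(Phi^k nu) = N(nu) + 2 (nu_{n-k+1} + ... + nu_n) + k, the
   triangularity survives.

   By triangularity the E_mu span, and by the vanishing conditions the coefficients
   of a polynomial on them can be read off from its values; this gives all the
   uniqueness statements. Finally T_i preserves condition (i), and at a descent of
   mu it carries the coefficients delta_{tau,mu} to delta_{tau,s_i mu}, because
   T_i x^nu only involves x^nu, x^{s_i nu} and monomials of smaller N. Each letter
   of a reduced word of sigma_mu acts at a descent, since its length is inv(mu). *)

Require Import Defs.
From HB Require Import structures.
From mathcomp Require Import all_boot all_order all_algebra all_fingroup.
From mathcomp Require Import fraction.
From mathcomp Require Import mpoly.
From mathcomp Require Import ring zify.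
From Stdlib Require Import ClassicalEpsilon.
Import GRing.Theory.
Set Implicit Arguments.
Unset Strict Implicit.
Unset Printing Implicit Defensive.
Local Open Scope ring_scope.

(** * Compositions *)

Section Compositions.
Variable n : nat.
Implicit Types (m mu nu lambda : 'X_{1..n}) (s : 'S_n) (a b : 'I_n).

Definition normsq m : nat := (\sum_(i < n) m i ^ 2)%N.

Definition ninv m : nat :=
  (\sum_(p : 'I_n * 'I_n) ((p.1 < p.2) && (m p.1 < m p.2)))%N.

Definition nsupp m : nat := (\sum_(i < n) (m i != 0))%N.

Lemma sactE s m i : sact s m i = m ((s^-1)%g i).
Proof. by rewrite mnmE. Qed.

Lemma sact_tpermE a b m i : sact (tperm a b) m i = m (tperm a b i).
Proof. by rewrite sactE tpermV. Qed.

Lemma sact1 m : sact 1 m = m.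
Proof. by apply/mnmP => i; rewrite sactE invg1 perm1. Qed.

Lemma sactM s1 s2 m : sact (s1 * s2)%g m = sact s2 (sact s1 m).
Proof. by apply/mnmP => i; rewrite !sactE invMg permM. Qed.

Lemma sact_tpermK a b m : sact (tperm a b) (sact (tperm a b) m) = m.
Proof. by rewrite -sactM tperm2 sact1. Qed.

Lemma inSn_refl m : inSn m m.
Proof. by exists 1%g; rewrite sact1. Qed.

Lemma inSn_sym m mu : inSn m mu -> inSn mu m.
Proof. by case=> s ->; exists s^-1%g; rewrite -sactM mulgV sact1. Qed.

Lemma inSn_trans m mu nu : inSn m mu -> inSn mu nu -> inSn m nu.
Proof. by case=> s -> [s' ->]; exists (s * s')%g; rewrite sactM. Qed.

Lemma inSn_sact s m : inSn m (sact s m).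
Proof. by exists s. Qed.

Lemma sum_sact (F : nat -> nat) s m :
  (\sum_(i < n) F (sact s m i) = \sum_(i < n) F (m i))%N.
Proof.
rewrite [RHS](reindex_inj (@perm_inj _ s^-1%g)).
by apply: eq_bigr => i _; rewrite sactE.
Qed.

Lemma normsq_inSn m mu : inSn m mu -> normsq mu = normsq m.
Proof. by case=> s ->; exact: (sum_sact (fun k => k ^ 2)%N). Qed.

Lemma nsupp_inSn m mu : inSn m mu -> nsupp mu = nsupp m.
Proof. by case=> s ->; exact: (sum_sact (fun k => k != 0)%N). Qed.

Lemma mdeg_inSn m mu : inSn m mu -> mdeg mu = mdeg m.
Proof. by case=> s ->; rewrite !mdegE; exact: (sum_sact id). Qed.

Lemma ltn_tperm_adj a b (i j : 'I_n) : b = a.+1 :> nat ->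
  (i, j) != (a, b) -> (i, j) != (b, a) ->
  (tperm a b i < tperm a b j)%N = (i < j)%N.
Proof.
rewrite !xpair_eqE -!val_eqE /= => ab.
by case: tpermP => [->|->|/eqP + /eqP]; case: tpermP => [->|->|/eqP + /eqP];
  rewrite -?val_eqE /=; lia.
Qed.

(** Only the pairs (a, b) and (b, a) change their order. With both comparisons present, one equation
    covers ascent, descent and tie. *)
Lemma ninv_swap a b m : b = a.+1 :> nat ->
  (ninv (sact (tperm a b) m) + (m a < m b) = ninv m + (m b < m a))%N.
Proof.
move=> ab; pose h (p : 'I_n * 'I_n) := (tperm a b p.1, tperm a b p.2).
have hK : involutive h by case=> i j; rewrite /h /= !tpermK.
have ba : (b, a) != (a, b) by rewrite xpair_eqE -!val_eqE /=; lia.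
rewrite /ninv (reindex_inj (inv_inj hK)) /=.
rewrite (bigD1 (a, b)) // (bigD1 (b, a)) //=.
rewrite [in RHS](bigD1 (a, b)) // [in RHS](bigD1 (b, a)) //=.
rewrite !sact_tpermE !tpermL !tpermR.
have -> : (a < b)%N by rewrite ab.
have -> : (b < a)%N = false by rewrite ab; lia.
rewrite [X in (_ + (_ + X) + _)%N](eq_bigr
  (fun p : 'I_n * 'I_n => ((p.1 < p.2) && (m p.1 < m p.2) : nat)%N)) /=;
  first by rewrite tpermL; lia.
move=> [i j] /andP[ij ij'] /=.
by rewrite !sact_tpermE !tpermK ltn_tperm_adj.
Qed.

Lemma ascent_or_partition m :
  (exists a b, b = a.+1 :> nat /\ (m a < m b)%N) \/ is_partition m.
Proof.
case: (boolP [exists a : 'I_n, exists b : 'I_n,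
              (val b == a.+1) && (m a < m b)%N]).
  by case/existsP => a /existsP[b /andP[/eqP ab lt]]; left; exists a, b.
move=> /existsPn H; right => i j ij.
have H' a b : b = a.+1 :> nat -> (m b <= m a)%N.
  move=> ab; have /existsPn/(_ b) := H a.
  by rewrite /= ab eqxx /= -leqNgt.
have [k kE] : exists k, k = (j - i)%N by eexists.
elim: k j ij kE => [|k IH] j ij kE.
  by have -> : j = i by apply: val_inj; rewrite /=; lia.
have jn : (j.-1 < n)%N by have := ltn_ord j; lia.
have h : j = (Ordinal jn).+1 :> nat by rewrite /=; lia.
by apply: leq_trans (H' _ _ h) (IH (Ordinal jn) _ _); rewrite /=; lia.
Qed.

Lemma ninv_partition m : is_partition m -> ninv m = 0%N.
Proof.
move=> H; apply: big1 => -[i j] _ /=.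
by case: ltnP => //= ij; rewrite ltnNge H // ltnW.
Qed.

Lemma ascent_swap a b m : b = a.+1 :> nat -> (m a < m b)%N ->
  [/\ (sact (tperm a b) m b < sact (tperm a b) m a)%N,
      (ninv (sact (tperm a b) m)).+1 = ninv m &
      m = sact (tperm a b) (sact (tperm a b) m)].
Proof.
move=> ab lt; rewrite !sact_tpermE tpermL tpermR sact_tpermK; split=> //.
by have := ninv_swap m ab; rewrite lt [(m b < m a)%N]ltnNge (ltnW lt) /=; lia.
Qed.

(** Undoing an ascent lowers the number of inversions, so swaps at descents reach every composition
    from a partition. *)
Lemma composition_ind (P : 'X_{1..n} -> Prop) :
  (forall m, is_partition m -> P m) ->
  (forall a b m, b = a.+1 :> nat -> (m b < m a)%N -> P m ->
    P (sact (tperm a b) m)) ->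
  forall m, P m.
Proof.
move=> Ppart Pstep m; have [k kE] : exists k, k = ninv m by eexists.
elim: k m kE => [|k IH] m kE; have [[a [b [ab lt]]]|] := ascent_or_partition m;
  try exact: Ppart; have [lt' E' ->] := ascent_swap ab lt; first by lia.
by apply: Pstep => //; apply: IH; lia.
Qed.

(** Read as lists, both are sorted and permutations of each other. *)
Lemma inSn_partition_unique lambda mu :
  is_partition lambda -> is_partition mu -> inSn lambda mu -> mu = lambda.
Proof.
have srt m : is_partition m -> sorted geq [seq m i | i <- enum 'I_n].
  move=> H; rewrite sorted_map; apply: (@sub_sorted _ (relpre val leq)).
    by move=> i j /=; exact: H.
  by rewrite -sorted_map val_enum_ord iota_sorted.
move=> Hl Hm [s E].
suff /eq_in_map H : [seq mu i | i <- enum 'I_n] = [seq lambda i | i <- enum 'I_n].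
  by apply/mnmP => i; apply: H; rewrite mem_enum.
apply: (@sorted_eq _ geq); try exact: srt.
- by move=> y x z /= h1 h2; exact: leq_trans h2 h1.
- by move=> x y /= h; apply/eqP; rewrite eqn_leq andbC.
have -> : [seq mu i | i <- enum 'I_n]
        = [seq lambda i | i <- [seq (s^-1)%g i | i <- enum 'I_n]].
  by rewrite -[RHS]map_comp; apply: eq_map => i /=; rewrite E sactE.
apply: perm_map; apply: uniq_perm; rewrite ?enum_uniq //.
  by rewrite map_inj_uniq ?enum_uniq //; exact: perm_inj.
move=> i; rewrite mem_enum inE; apply/mapP; exists (s i); first by rewrite mem_enum.
by rewrite permK.
Qed.

Lemma ninv_tperm_le a b m : b = a.+1 :> nat ->
  (ninv m <= (ninv (sact (tperm a b) m)).+1)%N.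
Proof. by move/(ninv_swap m); case: ltnP; case: ltnP; lia. Qed.

(** With the sum fixed, the new exponents lie strictly between the old ones, so convexity of the
    square applies. *)
Lemma normsq_swap_lt a b m mu : a != b ->
  (forall i, i != a -> i != b -> mu i = m i) ->
  (mu a + mu b = m a + m b)%N ->
  (minn (m a) (m b) < mu a)%N -> (minn (m a) (m b) < mu b)%N ->
  (normsq mu < normsq m)%N.
Proof.
have split_ab m' : a != b -> normsq m' =
    (m' a ^ 2 + (m' b ^ 2 + \sum_(i < n | (i != a) && (i != b)) m' i ^ 2))%N.
  by move=> ab; rewrite /normsq (bigD1 a) // (bigD1 b) 1?eq_sym.
move=> ab H; rewrite !split_ab // [X in (_ + (_ + X) < _)%N](eq_bigr
  (fun i => m i ^ 2)%N); last by move=> i /andP[h1 h2]; rewrite H.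
move: (\sum_(_ < _ | _) _)%N => S h1 h2 h3.
rewrite !addnA ltn_add2r -!mulnn; nia.
Qed.

End Compositions.

(** * The interpolation points *)

Definition independent (K : fieldType) (q t : K) : Prop :=
  forall a b c d, q ^+ a * t ^+ b = q ^+ c * t ^+ d -> a = c /\ b = d.

(** Coefficients of powers of t give b = d; degrees in q then give a = c. *)
Lemma qq_tt_independent : independent qq tt.
Proof.
move=> a b c d; rewrite /qq /tt -!tofracXn -!tofracM => /eqP.
rewrite tofrac_eq -!polyC_exp => /eqP E.
have coefE i j k : ((('X : {poly rat}) ^+ i)%:P * 'X^j)`_k = (if k == j then 'X^i else 0).
  by rewrite coefCM coefXn; case: eqP; rewrite ?mulr1 ?mulr0.
have := coefE a b b; rewrite E coefE eqxx; case: eqP => [-> |_ /eqP]; last first.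
  by rewrite eq_sym expf_eq0 polyX_eq0 andbF.
by move/(congr1 (fun p : {poly rat} => size p)); rewrite !size_polyXn => -[->].
Qed.

Section Spectrum.
Variables (K : fieldType) (q t : K).
Hypothesis qt_indep : independent q t.

Lemma indep_t_neq0 : t != 0.
Proof.
apply/eqP => t0; have [] := @qt_indep 0 1 0 2; last by [].
by rewrite t0 !expr0n.
Qed.

Lemma indep_q_neq0 : q != 0.
Proof.
apply/eqP => q0; have [] := @qt_indep 1 0 2 0; last by [].
by rewrite q0 !expr0n.
Qed.

Lemma indep_t_neq1 : t != 1.
Proof.
by apply/eqP => t1; have [] := @qt_indep 0 1 0 0; rewrite ?t1 ?expr1n.
Qed.

(** Clearing denominators reduces this to independence. The case e = 0 compares coordinates; e = 1
    handles zeros of t x_a - x_b. *)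
Lemma qt_div_inj (a b c d e : nat) :
  t ^+ e * (q ^+ a / t ^+ b) = q ^+ c / t ^+ d -> a = c.
Proof.
have tX k : t ^+ k != 0 by rewrite expf_neq0 // indep_t_neq0.
move=> E; have [//] : a = c /\ (e + d)%N = b; apply: qt_indep.
rewrite exprD mulrA.
have -> : q ^+ a * t ^+ e * t ^+ d = (t ^+ e * (q ^+ a / t ^+ b)) * t ^+ b * t ^+ d.
  by rewrite mulrA divfK // [q ^+ a * _]mulrC.
by rewrite E mulrAC divfK.
Qed.

Lemma kmuE n (nu : 'X_{1..n}) i : kmu nu i =
  (\sum_(j < n) (if j < i then nu i < nu j else (i < j) && (nu i <= nu j)))%N.
Proof.
have cardE (A : pred 'I_n) : #|[set j | A j]| = (\sum_(j < n) A j)%N.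
  by rewrite -sum1dep_card big_mkcond; apply: eq_bigr => j _; case: (A j).
rewrite /kmu !cardE -big_split /=; apply: eq_bigr => j _.
by case: ltngtP => //= _; rewrite addn0.
Qed.

(* [spoint qq tt] is [tilde]; only the independence of [q] and [t] is needed. *)
Definition spoint n (nu : 'X_{1..n}) (i : 'I_n) : K := q ^+ nu i / t ^+ kmu nu i.

Section Adjacent.
Variable n : nat.
Implicit Types (nu : 'X_{1..n}) (a b : 'I_n).

Lemma spoint_neq0 nu i : spoint nu i != 0.
Proof.
by rewrite mulf_neq0 ?invr_eq0 // expf_neq0 ?indep_q_neq0 ?indep_t_neq0.
Qed.

Lemma spoint_eq nu i j e : t ^+ e * spoint nu i = spoint nu j -> nu i = nu j.
Proof. exact: qt_div_inj. Qed.

(** Only the positions a and b change their relative order, and for distinct entries strict and weak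
    comparison agree. *)
Lemma kmu_swap a b nu i : b = a.+1 :> nat -> nu a != nu b ->
  kmu (sact (tperm a b) nu) i = kmu nu (tperm a b i).
Proof.
move=> ab nab; rewrite !kmuE (reindex_inj (@perm_inj _ (tperm a b))) /=.
apply: eq_bigr => j _; rewrite !sact_tpermE tpermK.
set i' := tperm a b i; have -> : i = tperm a b i' by rewrite tpermK.
have lt_ba : (b < a)%N = false by rewrite ab; lia.
have lt_ab : (a < b)%N by rewrite ab.
have [[-> ->]|/eqP h1] := (j, i') =P (a, b).
  by rewrite tpermL tpermR lt_ba lt_ab /= ltn_neqAle ?nab // eq_sym nab.
have [[-> ->]|/eqP h2] := (j, i') =P (b, a).
  by rewrite tpermL tpermR lt_ba lt_ab /= ltn_neqAle ?nab // eq_sym nab.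
by rewrite !ltn_tperm_adj // xpair_eqE andbC -xpair_eqE.
Qed.

Lemma spoint_swap a b nu : b = a.+1 :> nat -> nu a != nu b ->
  spoint (sact (tperm a b) nu) =1 spoint nu \o tperm a b.
Proof. by move=> ab nab i; rewrite /spoint /= kmu_swap // sact_tpermE. Qed.

(** Ties are broken by position, so k drops by one from a to b. Hence t x_a - x_b vanishes at such a
    point. *)
Lemma spoint_flat a b nu : b = a.+1 :> nat -> nu a = nu b ->
  spoint nu b = t * spoint nu a.
Proof.
move=> ab nab; have : kmu nu a = (kmu nu b).+1.
  rewrite !kmuE (bigD1 b) // [in RHS](bigD1 b) //= ltnn /=.
  have -> : (b < a)%N = false by rewrite ab; lia.
  rewrite ab ltnSn nab leqnn add1n add0n; congr _.+1.
  apply: eq_bigr => j jb; have [->|ja] := eqVneq j a.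
    by rewrite ltnn ltnSn nab ltnn.
  move: jb ja; rewrite -!val_eqE /= ab => jb ja.
  have -> : (j < a.+1)%N = (j < a)%N by lia.
  by have -> : (a.+1 < j)%N = (a < j)%N by lia.
rewrite /spoint => ->; rewrite nab exprS.
by field; rewrite indep_t_neq0 expf_neq0 ?indep_t_neq0.
Qed.

(** This permits division by x_a - x_b at every interpolation point: the coordinates differ by the
    factor t or in their powers of q. *)
Lemma spoint_adj_neq a b nu : b = a.+1 :> nat -> spoint nu a != spoint nu b.
Proof.
move=> ab; have [nab|] := eqVneq (nu a) (nu b).
  rewrite (spoint_flat ab nab) eq_sym -subr_eq0 -{2}[spoint nu a]mul1r -mulrBl.
  by rewrite mulf_neq0 ?spoint_neq0 // subr_eq0 indep_t_neq1.
by apply: contra => /eqP E; apply/eqP/(@spoint_eq _ _ _ 0); rewrite expr0 mul1r.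
Qed.

End Adjacent.
End Spectrum.

(** * Demazure-Lusztig operators *)

Section DemazureLusztig.
Variables (K : fieldType) (t : K) (n : nat) (a b : 'I_n).
Hypothesis neq_ab : a != b.
Implicit Types (m nu tau : 'X_{1..n}) (f g : {mpoly K[n]}).

Local Notation s := (tperm a b).

(** T_i as a relation with its denominator cleared; [dl_exists] shows that the quotient is a
    polynomial. *)
Definition is_dl f g : Prop :=
  ('X_a - 'X_b) * g =
    t *: (('X_a - 'X_b) * f) - (t *: 'X_a - 'X_b) * (f - msym s f).

Lemma subX_neq0 : ('X_a - 'X_b : {mpoly K[n]}) != 0.
Proof.
rewrite subr_eq0; apply/eqP => /(congr1 (mcoeff U_(a)%MM)).
rewrite !mcoeffX eqxx eq_mnm1 eq_sym (negbTE neq_ab) => /eqP.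
by rewrite oner_eq0.
Qed.

Lemma is_dl_unique f g g' : is_dl f g -> is_dl f g' -> g = g'.
Proof. by rewrite /is_dl => <- /(mulfI subX_neq0). Qed.

Lemma is_dl_lin c f f' g g' :
  is_dl f g -> is_dl f' g' -> is_dl (c *: f + f') (c *: g + g').
Proof.
rewrite /is_dl msymD msymZ -!mul_mpolyC => E E'.
by rewrite mulrDr mulrCA E E'; ring.
Qed.

Lemma mdeg_swap m nu :
  (forall i, i != a -> i != b -> nu i = m i) ->
  (nu a + nu b = m a + m b)%N -> mdeg nu = mdeg m.
Proof.
move=> H E; rewrite !mdegE (bigD1 a) // (bigD1 b) 1?eq_sym //=.
rewrite [RHS](bigD1 a) // [in RHS](bigD1 b) 1?eq_sym //= !addnA E.
by congr addn; apply: eq_bigr => i /andP[]; exact: H.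
Qed.

(* [S] is the sum of the monomials strictly between x^m and its swap, along the
   segment that moves exponent from x_a to x_b. *)
Lemma dl_middle_terms m : (m b < m a)%N ->
  exists S : {mpoly K[n]},
    ('X_a - 'X_b) * S = 'X_b * 'X_[m] - 'X_a * 'X_[sact s m] /\
    forall nu, S@_nu != 0 -> mdeg nu = mdeg m /\ (normsq nu < normsq m)%N.
Proof.
move=> lt; pose mv k : 'X_{1..n} := [multinom
  if i == a then (m a - k)%N else if i == b then (m b + k)%N else m i | i < n].
have mva k : mv k a = (m a - k)%N by rewrite mnmE eqxx.
have mvb k : mv k b = (m b + k)%N by rewrite mnmE eq_sym (negbTE neq_ab) eqxx.
have mvi k i : i != a -> i != b -> mv k i = m i.
  by move=> ia ib; rewrite mnmE (negbTE ia) (negbTE ib).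
have step k : (k < m a)%N ->
    'X_a * 'X_[mv k.+1] = 'X_b * 'X_[mv k] :> {mpoly K[n]}.
  move=> km; rewrite -!mpolyXD; congr 'X_[_]; apply/mnmP => i.
  rewrite !mnmDE !mnm1E; have [->|ia] := eqVneq i a.
    by rewrite !mva ?eqxx [b == a]eq_sym (negbTE neq_ab); lia.
  have [->|ib] := eqVneq i b; first by rewrite !mvb; lia.
  by rewrite !mvi.
(* [mv 0] is m and [mv (m a - m b)] is its swap; the d points between are summed, and [step] makes
   the product telescope. *)
pose d := (m a - m b).-1; exists (\sum_(0 <= k < d) 'X_[mv k.+1]); split.
  have -> : 'X_b * 'X_[m] - 'X_a * 'X_[sact s m]
          = - ('X_b * 'X_[mv d] - 'X_b * 'X_[mv 0%N]) :> {mpoly K[n]}.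
    rewrite -[in RHS]step; last by rewrite /d; lia.
    rewrite opprB; congr (_ * 'X_[_] - _ * 'X_[_]); apply/mnmP => i.
      have [->|ia] := eqVneq i a; first by rewrite mva; lia.
      by have [->|ib] := eqVneq i b; rewrite ?mvb ?mvi //; lia.
    rewrite sact_tpermE; case: tpermP => [->|->|/eqP ? /eqP ?];
      by rewrite ?mva ?mvb ?mvi // /d; lia.
  rewrite -(telescope_sumr (fun k => 'X_b * 'X_[mv k])) // mulr_sumr -sumrN.
  apply: eq_big_nat => k /andP[_ kd].
  by rewrite mulrBl step ?opprB //; move: kd; rewrite /d; lia.
move=> nu; rewrite big_mkord raddf_sum /=.
case: (boolP [exists k : 'I_d, mv k.+1 == nu]) => [/existsP[k /eqP <-] _|].
  have := ltn_ord k; rewrite /d => kd; split.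
    by apply: mdeg_swap => [i|]; [exact: mvi | rewrite mva mvb; lia].
  apply: (normsq_swap_lt neq_ab) => [i|||]; rewrite ?mva ?mvb; try lia.
  exact: mvi.
move/existsPn => H; rewrite big1 ?eqxx // => k _.
by rewrite mcoeffX (negbTE (H k)).
Qed.

(** With [dl_swap], the coefficients of T_i x^m at x^m and at its swap. In a tie these monomials
    coincide, and all is booked on the diagonal. *)
Definition dl_diag m : K :=
  if (m a < m b)%N then t - 1 else if (m b < m a)%N then 0 else t.
Definition dl_swap m : K :=
  if (m a < m b)%N then t else if (m b < m a)%N then 1 else 0.

Lemma dl_monomial m : exists L,
  is_dl 'X_[m] (dl_diag m *: 'X_[m] + dl_swap m *: 'X_[sact s m] + L) /\
  forall nu, L@_nu != 0 -> mdeg nu = mdeg m /\ (normsq nu < normsq m)%N.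
Proof.
have symX nu : msym s 'X_[nu] = 'X_[sact s nu] :> {mpoly K[n]}.
  by rewrite msymX; congr 'X_[_].
rewrite /dl_diag /dl_swap; case: ltngtP => h.
- have [|S [SE supS]] := @dl_middle_terms (sact s m).
    by rewrite !sact_tpermE tpermL tpermR.
  rewrite sact_tpermK in SE.
  exists ((t - 1) *: S); split.
    rewrite /is_dl symX -!mul_mpolyC !mulrDr [('X_a - 'X_b) * (_ * S)]mulrCA SE.
    rewrite mpolyCB mpolyC1; ring.
  move=> nu; rewrite mcoeffZ mulf_eq0 negb_or => /andP[_ /supS].
  by rewrite (mdeg_inSn (inSn_sact _ _)) (normsq_inSn (inSn_sact _ _)).
- have [S [SE supS]] := dl_middle_terms h.
  exists ((1 - t) *: S); split.
    rewrite /is_dl symX -!mul_mpolyC !mulrDr [('X_a - 'X_b) * (_ * S)]mulrCA SE.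
    rewrite mpolyCB mpolyC1 mpolyC0; ring.
  by move=> nu; rewrite mcoeffZ mulf_eq0 negb_or => /andP[_ /supS].
exists 0; split=> [|nu]; last by rewrite mcoeff0 eqxx.
rewrite /is_dl symX; have -> : sact s m = m.
  by apply/mnmP => i; rewrite sact_tpermE; case: tpermP => // ->.
by rewrite subrr mulr0 scale0r !addr0 subr0 -scalerAr.
Qed.

(** By linearity from monomials. The lower terms of T_i x^m have the degree of m and smaller
    [normsq], so they reach x^tau only from monomials that the hypothesis on tau excludes. *)
Lemma dl_exists f : exists g, [/\ is_dl f g,
  (forall nu, g@_nu != 0 -> exists2 m, f@_m != 0 & mdeg m = mdeg nu) &
  forall tau,
    (forall m, f@_m != 0 -> mdeg m = mdeg tau -> (normsq m <= normsq tau)%N) ->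
    g@_tau = dl_diag tau * f@_tau + dl_swap (sact s tau) * f@_(sact s tau)].
Proof.
elim/mpolyind: f => [|c m p mp c0 [g [gE gdeg gco]]].
  exists 0; split=> [|nu|tau _]; last by rewrite !mcoeff0 !mulr0 addr0.
    by rewrite /is_dl msym0 subr0 !mulr0 scaler0 subr0.
  by rewrite mcoeff0 eqxx.
have [L [LE supL]] := dl_monomial m.
have pm0 : p@_m = 0 by exact: memN_msupp_eq0.
have cpm nu : nu != m -> (c *: 'X_[m] + p)@_nu = p@_nu.
  by move=> h; rewrite mcoeffD mcoeffZ mcoeffX eq_sym (negbTE h) mulr0 add0r.
have cpmm : (c *: 'X_[m] + p)@_m = c.
  by rewrite mcoeffD mcoeffZ mcoeffX eqxx mulr1 pm0 addr0.
have sup m' : p@_m' != 0 -> (c *: 'X_[m] + p)@_m' != 0.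
  by move=> h; rewrite cpm //; apply: contra h => /eqP ->; rewrite pm0.
eexists; split; first exact: is_dl_lin LE gE.
- move=> nu; rewrite mcoeffD; have [->|gn _] := eqVneq g@_nu 0; last first.
    by have [m' h1 h2] := gdeg _ gn; exists m' => //; exact: sup.
  rewrite addr0 => h; exists m; first by rewrite cpmm.
  move: h; rewrite mcoeffZ mulf_eq0 negb_or => /andP[_].
  rewrite !mcoeffD !mcoeffZ !mcoeffX.
  have [<- //|_] := eqVneq m nu; have [<- _|_] := eqVneq (sact s m) nu.
    by rewrite (mdeg_inSn (inSn_sact _ _)).
  by rewrite !mulr0 !add0r => /supL[].
move=> tau H; rewrite mcoeffD gco; last by move=> m' /sup; exact: H.
rewrite mcoeffZ !mcoeffD !mcoeffZ !mcoeffX.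
have -> : L@_tau = 0.
  apply/eqP/negP => /negP/supL[d1 d2].
  by have := H m; rewrite cpmm c0 d1 leqNgt d2 => /(_ isT erefl).
have -> : (m == sact s tau) = (sact s m == tau).
  by apply/eqP/eqP => [->|<-]; rewrite sact_tpermK.
have [E|_] := eqVneq (sact s m) tau; last first.
  by have [->|_] := eqVneq m tau; rewrite /= ?mulr1n ?mulr0n; ring.
have -> : sact s tau = m by rewrite -E sact_tpermK.
by have [<-|_] := eqVneq m tau; rewrite /= ?mulr1n ?mulr0n; ring.
Qed.

Lemma is_dl_msize f g d : is_dl f g -> (msize f <= d)%N -> (msize g <= d)%N.
Proof.
move=> fg fd; have [g' [fg' gdeg _]] := dl_exists f.
rewrite (is_dl_unique fg fg') msizeE.
apply/bigmax_leqP_seq => nu; rewrite mcoeff_msupp => /gdeg[m + <-] _.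
by rewrite -mcoeff_msupp => /msize_mdeg_lt h; exact: leq_trans h fd.
Qed.

Lemma is_dl_coef f g tau : is_dl f g ->
  (forall m, f@_m != 0 -> mdeg m = mdeg tau -> (normsq m <= normsq tau)%N) ->
  g@_tau = dl_diag tau * f@_tau + dl_swap (sact s tau) * f@_(sact s tau).
Proof.
by move=> fg; have [g' [fg' _ gco]] := dl_exists f; rewrite (is_dl_unique fg fg'); exact: gco.
Qed.

Lemma is_dl_meval f g (v : 'I_n -> K) : is_dl f g ->
  (v a - v b) * g.@[v] =
    t * ((v a - v b) * f.@[v]) - (t * v a - v b) * (f.@[v] - f.@[v \o s]).
Proof.
move/(congr1 (meval v)); rewrite !(mevalM, mevalB, mevalZ, mevalXU).
suff -> : (msym s f).@[v] = f.@[v \o s] by [].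
elim/mpolyind: f => [|c m p _ _ IH]; first by rewrite msym0 !meval0.
rewrite msymD msymZ !mevalD !mevalZ msymX !mevalX IH; congr (_ * _ + _).
rewrite (reindex_inj (@perm_inj _ s)) /=; apply: eq_bigr => i _.
by rewrite mnmE tpermV tpermK.
Qed.

End DemazureLusztig.

(** * The cyclic shift *)

Lemma msize_leP (K : fieldType) n (g : {mpoly K[n]}) d :
  (msize g <= d.+1)%N <-> (forall nu, g@_nu != 0 -> (mdeg nu <= d)%N).
Proof.
split=> [gd nu|H].
  by rewrite -mcoeff_msupp => /msize_mdeg_lt h; rewrite -ltnS (leq_trans h gd).
rewrite msizeE; apply/bigmax_leqP_seq => nu; rewrite mcoeff_msupp => /H h _.
by rewrite ltnS.
Qed.

(** Nonvanishing at the own point replaces a normalized coefficient: the shift operator preserves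
    it, and it makes evaluation triangular. *)
Definition interpolates (K : fieldType) (q t : K) n (mu : 'X_{1..n})
    (g : {mpoly K[n]}) : Prop :=
  [/\ (msize g <= (mdeg mu).+1)%N,
      forall nu, (mdeg nu <= mdeg mu)%N -> nu != mu -> g.@[spoint q t nu] = 0 &
      g.@[spoint q t mu] != 0].

Section CyclicShift.
Variable m : nat.
Implicit Types (nu tau : 'X_{1..m.+1}).
Local Notation n := m.+1.

(* [mphi nu] is (nu_n + 1, nu_1, ..., nu_(n-1)), and [pphi] below is the matching
   operator g |-> (x_1 - t^(1-n)) g(x_2, ..., x_n, x_1 / q). *)
Definition mrot nu : 'X_{1..n} := [multinom nu (ord_pred i) | i < n].
Definition mphi nu : 'X_{1..n} := (U_(ord0) + mrot nu)%MM.

Lemma ordS_val (i : 'I_n) : ordS i = (if i == m :> nat then 0 else i.+1)%N :> nat.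
Proof.
rewrite /=; have := ltn_ord i; rewrite ltnS leq_eqVlt.
by case: eqP => [-> _|_ /= h]; rewrite ?modnn // modn_small.
Qed.

Lemma mphiE nu i : mphi nu (ordS i) = (nu i + (i == m :> nat))%N.
Proof.
rewrite mnmDE mnm1E mnmE ordSK addnC; congr (_ + nat_of_bool _)%N.
have -> : (ord0 == ordS i) = (nat_of_ord (ordS i) == 0)%N by rewrite eq_sym -val_eqE.
by rewrite ordS_val; case: ifP.
Qed.

Lemma ordS_inj : injective (@ordS n).
Proof. exact: can_inj (@ordSK n). Qed.

Lemma mrot_inj : injective mrot.
Proof.
by move=> nu tau /mnmP E; apply/mnmP => i; have := E (ordS i); rewrite !mnmE ordSK.
Qed.

Lemma mphi_inj : injective mphi.
Proof. by move=> nu tau /addmI/mrot_inj. Qed.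

Lemma mrot_surj tau : exists nu, tau = mrot nu.
Proof.
exists [multinom tau (ordS i) | i < n].
by apply/mnmP => i; rewrite !mnmE ord_predK.
Qed.

Lemma mphi_surj tau : tau ord0 != 0%N -> exists nu, tau = mphi nu.
Proof.
move=> h; have [nu E] := mrot_surj (tau - U_(ord0))%MM.
by exists nu; rewrite /mphi -E addmC submK // lep1mP.
Qed.

Lemma mdeg_mrot nu : mdeg (mrot nu) = mdeg nu.
Proof.
rewrite !mdegE (reindex_inj ordS_inj) /=.
by apply: eq_bigr => i _; rewrite mnmE ordSK.
Qed.

Lemma mdeg_mphi nu : mdeg (mphi nu) = (mdeg nu).+1.
Proof. by rewrite mdegD mdeg1 mdeg_mrot. Qed.

Lemma normsq_mphi nu : normsq (mphi nu) = (normsq nu + nu ord_max * 2 + 1)%N.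
Proof.
rewrite /normsq (reindex_inj ordS_inj) /= (bigD1 ord_max) //=.
rewrite [in RHS](bigD1 ord_max) //= mphiE eqxx.
rewrite (eq_bigr (fun i => nu i ^ 2)%N); last first.
  by move=> i; rewrite -val_eqE mphiE /= => /negbTE->; rewrite addn0.
by move: (\sum_(_ < _ | _) _)%N => S; rewrite -!mulnn; lia.
Qed.

Lemma iter_mphiE k nu i : (k <= n)%N ->
  iter k mphi nu i =
    (if i < k then (nu (inord (n - k + i))).+1 else nu (inord (i - k)))%N.
Proof.
elim: k i => [|k IH] i kn; first by rewrite /= subn0 inord_val.
rewrite iterS -(ord_predK i); move: (ord_pred i) => j.
rewrite mphiE IH ?(ltnW kn) // ordS_val; case: eqP => [jm|/eqP jm].
  rewrite /= ltnNge jm -ltnS kn /= addn1; congr (nu _).+1; congr inord; lia.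
rewrite addn0 ltnS subSS; case: ltnP => // jk; congr (nu _).+1; congr inord; lia.
Qed.

Lemma mdeg_iter_mphi k nu : mdeg (iter k mphi nu) = (mdeg nu + k)%N.
Proof. by elim: k => [|k IH]; rewrite ?addn0 // iterS mdeg_mphi IH addnS. Qed.

(** Each shift adds 2x + 1 for the entry x that it moves to the front; as k is at most n, these are
    the last k entries, once each. *)
Lemma normsq_iter_mphi k nu : (k <= n)%N -> normsq (iter k mphi nu) =
  (normsq nu + (\sum_(i < n | n - k <= i) nu i) * 2 + k)%N.
Proof.
elim: k => [|k IH] kn; first by rewrite subn0 big_pred0 ?addn0 // => i; have := ltn_ord i; lia.
rewrite iterS normsq_mphi IH ?(ltnW kn) // iter_mphiE ?(ltnW kn) //= ltnNge -ltnS kn /=.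
rewrite [in RHS](bigD1 (inord (m - k))) /=; last by rewrite inordK; lia.
rewrite [in RHS](eq_bigl (fun i : 'I_n => n - k <= i)%N); first by lia.
move=> i; rewrite -val_eqE /= inordK; lia.
Qed.

(** * The interpolation points and [pphi] under the cyclic shift *)

Section Spectrum.
Variables (K : fieldType) (q t : K).
Hypothesis qt_indep : independent q t.
Local Notation sp := (spoint q t).

(** Moving the last entry to the front exchanges strict and weak comparisons with it; raising it by
    one compensates exactly. *)
Lemma kmu_mphi nu i : kmu (mphi nu) (ordS i) = kmu nu i.
Proof.
rewrite !kmuE (reindex_inj ordS_inj) /=; apply: eq_bigr => j _.
rewrite !mphiE -[((_ %% _) < (_ %% _))%N]/(ordS _ < ordS _)%N.
rewrite -[((_ %% _) < (_ %% _))%N]/(ordS _ < ordS _)%N !ordS_val.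
have := ltn_ord i; have := ltn_ord j; rewrite !ltnS.
case: (eqVneq (j : nat) m) => [->|jm]; case: (eqVneq (i : nat) m) => [->|im] jn ni;
  rewrite ?ltnn ?ltnS ?addn0 ?addn1 //=.
- have -> : (m < i)%N = false by lia.
  by have -> : (i < m)%N by lia.
- by have -> : (j < m)%N by lia.
Qed.

Lemma spoint_mphi nu i :
  sp (mphi nu) (ordS i) = q ^+ (i == m :> nat) * sp nu i.
Proof. by rewrite /spoint kmu_mphi mphiE addnC exprD mulrA. Qed.

(** All other entries are at least 0, so k is m = n - 1 at the first place. This is the root of the
    linear factor of [pphi]. *)
Lemma spoint_head0 nu : nu ord0 = 0%N -> sp nu ord0 = (t ^+ m)^-1.
Proof.
move=> h; rewrite /spoint h expr0 div1r; congr (_ ^+ _)^-1.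
rewrite kmuE big_ord_recl /= add0n (eq_bigr (fun=> 1%N)).
  by rewrite sum1_card card_ord.
by move=> j _; rewrite h.
Qed.

Lemma spoint_mphi_head nu : sp (mphi nu) ord0 != (t ^+ m)^-1.
Proof.
apply/eqP => E; have : mphi nu ord0 = 0%N.
  by apply: (@qt_div_inj _ _ _ qt_indep _ _ 0 m 0); rewrite expr0 mul1r div1r; exact: E.
by rewrite mnmDE mnm1E eqxx.
Qed.

Definition qrot (g : {mpoly K[n]}) : {mpoly K[n]} :=
  g \mPo [tuple q^-1 ^+ (i == m :> nat) *: 'X_(ordS i) | i < n].

Definition pphi (g : {mpoly K[n]}) : {mpoly K[n]} :=
  ('X_ord0 - ((t ^+ m)^-1)%:MP) * qrot g.

Lemma pphi_meval g nu : (pphi g).@[sp nu] = 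
  (sp nu ord0 - (t ^+ m)^-1) * g.@[fun i => q^-1 ^+ (i == m :> nat) * sp nu (ordS i)].
Proof.
rewrite /pphi mevalM mevalB mevalXU mevalC comp_mpoly_meval; congr (_ * _).
by apply: meval_eq => i; rewrite tnth_mktuple mevalZ mevalXU.
Qed.

Lemma pphi_meval_mphi g nu : (pphi g).@[sp (mphi nu)] =
  (sp (mphi nu) ord0 - (t ^+ m)^-1) * g.@[sp nu].
Proof.
rewrite pphi_meval; congr (_ * _); apply: meval_eq => i.
rewrite spoint_mphi mulrA -exprMn mulVf ?expr1n ?mul1r //.
exact: indep_q_neq0 qt_indep.
Qed.

Definition qrot_wt nu : K := \prod_(i < n) (q^-1 ^+ (i == m :> nat)) ^+ nu i.

Lemma qrot_wt_neq0 nu : qrot_wt nu != 0.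
Proof.
apply/prodf_neq0 => i _.
by rewrite !expf_neq0 // invr_eq0 (indep_q_neq0 qt_indep).
Qed.

Lemma qrot_coef g nu : (qrot g)@_(mrot nu) = qrot_wt nu * g@_nu.
Proof.
rewrite /qrot; elim/mpolyind: g => [|c k p _ _ IH].
  by rewrite comp_mpoly0 !mcoeff0 mulr0.
rewrite comp_mpolyD comp_mpolyZ !mcoeffD !mcoeffZ IH mulrDr; congr (_ + _).
rewrite mulrCA; congr (_ * _); rewrite comp_mpolyX.
under eq_bigr => i _ do rewrite tnth_mktuple exprZn.
rewrite scaler_prod mcoeffZ -/(qrot_wt k).
have -> : \prod_(i < n) 'X_(ordS i) ^+ k i = 'X_[mrot k] :> {mpoly K[n]}.
  rewrite mpolyXE_id [RHS](reindex_inj ordS_inj) /=.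
  by apply: eq_bigr => i _; rewrite mnmE ordSK.
rewrite !mcoeffX (inj_eq mrot_inj).
by case: eqP => [->|_]; rewrite ?mulr0.
Qed.

Lemma qrot_msize g d : (msize g <= d.+1)%N -> (msize (qrot g) <= d.+1)%N.
Proof.
rewrite !msize_leP => H tau; have [nu ->] := mrot_surj tau.
by rewrite qrot_coef mulf_eq0 negb_or mdeg_mrot => /andP[_ /H].
Qed.

Lemma mcoeff_X0M (g : {mpoly K[n]}) tau : tau ord0 = 0%N -> ('X_ord0 * g)@_tau = 0.
Proof.
move=> h; apply/eqP; rewrite mulrC mcoeff_eq0 (perm_mem (msuppMX _ _)).
apply/mapP => -[nu _ E]; move: h; rewrite E mnmDE mnm1E eqxx.
by [].
Qed.

(** In the top degree only the product with x_1 contributes. *)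
Lemma pphi_coef g nu : (msize g <= (mdeg nu).+1)%N ->
  (pphi g)@_(mphi nu) = qrot_wt nu * g@_nu.
Proof.
move=> gd; rewrite /pphi mulrBl mcoeffB mul_mpolyC mcoeffZ.
rewrite [(qrot g)@_(mphi nu)](_ : _ = 0) ?mulr0 ?subr0.
  by rewrite mulrC mcoeffMX qrot_coef.
apply: memN_msupp_eq0; apply: msize_mdeg_ge.
by rewrite mdeg_mphi; exact: qrot_msize.
Qed.

Lemma pphi_coef0 g d tau : (msize g <= d.+1)%N -> mdeg tau = d.+1 ->
  tau ord0 = 0%N -> (pphi g)@_tau = 0.
Proof.
move=> gd td t0; rewrite /pphi mulrBl mcoeffB mul_mpolyC mcoeffZ mcoeff_X0M //.
rewrite [(qrot g)@_tau](_ : _ = 0) ?mulr0 ?subr0 //.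
by apply: memN_msupp_eq0; apply: msize_mdeg_ge; rewrite td; exact: qrot_msize.
Qed.

Lemma pphi_msize g d : (msize g <= d.+1)%N -> (msize (pphi g) <= d.+2)%N.
Proof.
move=> /qrot_msize/msize_leP H; apply/msize_leP => tau.
rewrite /pphi mulrBl mcoeffB mul_mpolyC mcoeffZ.
have [h|h] := eqVneq (qrot g)@_tau 0; last by move=> _; exact: leqW (H _ h).
rewrite h mulr0 subr0; have [t0|/mphi_surj[nu ->]] := eqVneq (tau ord0) 0%N.
  by rewrite mcoeff_X0M ?eqxx.
by rewrite mulrC mcoeffMX => /H; rewrite mdeg_mphi mdeg_mrot.
Qed.

(** If nu_1 = 0, the linear factor vanishes; otherwise nu is the shift of a composition of degree
    one less, and the value is a multiple of that of g there. *)
Lemma pphi_interpolates mu g : interpolates q t mu g -> interpolates q t (mphi mu) (pphi g).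
Proof.
case=> gd gv gn; split.
- by rewrite mdeg_mphi; exact: pphi_msize.
- move=> nu; rewrite mdeg_mphi.
  have [n0 _ _|/mphi_surj[nu' ->]] := eqVneq (nu ord0) 0%N.
    by rewrite pphi_meval spoint_head0 // subrr mul0r.
  rewrite mdeg_mphi ltnS (inj_eq mphi_inj) => h1 h2.
  by rewrite pphi_meval_mphi gv ?mulr0.
by rewrite pphi_meval_mphi mulf_neq0 // subr_eq0 spoint_mphi_head.
Qed.

Lemma iter_pphi_interpolates k mu g :
  interpolates q t mu g -> interpolates q t (iter k mphi mu) (iter k pphi g).
Proof. by move=> H; elim: k => // k IH; exact: pphi_interpolates. Qed.

Lemma iter_pphi_coef k mu g : interpolates q t mu g -> g@_mu != 0 ->
  (iter k pphi g)@_(iter k mphi mu) != 0.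
Proof.
move=> H g0; elim: k => // k IH; rewrite !iterS pphi_coef ?mulf_neq0 ?qrot_wt_neq0 //.
by case: (iter_pphi_interpolates k H).
Qed.

Lemma iter_pphi_supp k mu g tau : interpolates q t mu g -> mdeg tau = (mdeg mu + k)%N ->
  (iter k pphi g)@_tau != 0 ->
  exists nu, [/\ mdeg nu = mdeg mu, tau = iter k mphi nu & g@_nu != 0].
Proof.
move=> H; elim: k tau => [|k IH] tau td; first by rewrite addn0 in td; exists tau.
have [gd _ _] := iter_pphi_interpolates k H; rewrite mdeg_iter_mphi in gd.
rewrite addnS in td; have [t0|/mphi_surj[nu E]] := eqVneq (tau ord0) 0%N.
  by rewrite iterS (pphi_coef0 gd td t0) eqxx.
have nd : mdeg nu = (mdeg mu + k)%N by apply: succn_inj; rewrite -mdeg_mphi -E.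
rewrite E iterS pphi_coef ?nd // mulf_eq0 negb_or => /andP[_ /(IH _ nd)].
by case=> nu' [h1 h2 h3]; exists nu'; rewrite iterS -h2.
Qed.

End Spectrum.
End CyclicShift.

(** * Existence of the interpolation polynomials *)

Section InterpolationBasis.
Variables (K : fieldType) (q t : K).
Hypothesis qt_indep : independent q t.
Local Notation sp := (spoint q t).

Definition below n (nu mu : 'X_{1..n}) : Prop :=
  [\/ nu = mu, (normsq nu < normsq mu)%N | inSn mu nu /\ (ninv nu < ninv mu)%N].

Definition is_Ebasis n (mu : 'X_{1..n}) (g : {mpoly K[n]}) : Prop :=
  [/\ interpolates q t mu g, g@_mu = 1 &
      forall nu, mdeg nu = mdeg mu -> g@_nu != 0 -> below nu mu].

(** At a tie the factor t x_a - x_b is 0; otherwise exchanging the two coordinates gives the point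
    of the swapped composition. *)
Lemma is_dl_meval_zero n (a b : 'I_n) (f g : {mpoly K[n]}) (nu : 'X_{1..n}) :
  b = a.+1 :> nat -> is_dl t a b f g -> f.@[sp nu] = 0 ->
  (nu a != nu b -> f.@[sp (sact (tperm a b) nu)] = 0) -> g.@[sp nu] = 0.
Proof.
move=> ab fg f0 fs0; have := is_dl_meval (sp nu) fg; rewrite f0.
have d0 : sp nu a - sp nu b != 0 by rewrite subr_eq0 spoint_adj_neq.
suff -> : (t * sp nu a - sp nu b) * (0 - f.@[sp nu \o tperm a b]) = 0.
  by rewrite !mulr0 subr0 => /eqP; rewrite mulf_eq0 (negbTE d0) => /eqP.
have [nab|nab] := eqVneq (nu a) (nu b).
  by rewrite (spoint_flat qt_indep ab nab) subrr mul0r.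
by rewrite -(meval_eq f (spoint_swap q t ab nab)) fs0 // subrr mulr0.
Qed.

Lemma Ebasis_swap n (a b : 'I_n) (mu : 'X_{1..n}) g : b = a.+1 :> nat -> (mu b < mu a)%N ->
  is_Ebasis mu g -> exists g', is_Ebasis (sact (tperm a b) mu) g'.
Proof.
move=> ab lt [[gd gv gn] g1 gsup]; set s := tperm a b; set mu' := sact s mu.
have neq_ab : a != b by rewrite -val_eqE /= ab; lia.
have mu_ab : mu a != mu b by rewrite neq_ltn lt orbT.
have mu'E : sact s mu' = mu by rewrite sact_tpermK.
have inv' : ninv mu' = (ninv mu).+1.
  by have := ninv_swap mu ab; rewrite -/s -/mu' lt ltnNge (ltnW lt) /=; lia.
have deg' : mdeg mu' = mdeg mu by exact: mdeg_inSn (inSn_sact _ _).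
have nsq' : normsq mu' = normsq mu by exact: normsq_inSn (inSn_sact _ _).
have neq' : mu' != mu by apply/eqP => E; move: inv'; rewrite E; lia.
have gmu' : g.@[sp mu'] = 0 by rewrite gv ?deg'.
have nsqg m tau : mdeg tau = mdeg mu -> (normsq mu <= normsq tau)%N ->
    g@_m != 0 -> mdeg m = mdeg tau -> (normsq m <= normsq tau)%N.
  move=> td tn gm md; apply: leq_trans tn.
  by have [->|/ltnW|[/normsq_inSn-> _]] := gsup m (etrans md td) gm.
have [h [hE _ _]] := dl_exists t neq_ab g.
(* Up to degree |mu|, T_i g can be nonzero only at the points of mu and mu'; c cancels the value at
   mu. *)
pose c := - (h.@[sp mu] / g.@[sp mu]).
exists (h + c *: g); split; first split.
- rewrite deg'; apply/msize_leP => nu; rewrite mcoeffD mcoeffZ.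
  have /msize_leP h1 := is_dl_msize neq_ab hE gd; move/msize_leP: gd => h2.
  have [E|/h1 //] := eqVneq h@_nu 0.
  by rewrite E add0r mulf_eq0 negb_or => /andP[_ /h2].
- move=> nu; rewrite deg' => nd nmu'; rewrite mevalD mevalZ.
  have [->|nmu] := eqVneq nu mu; first by rewrite /c mulNr divfK // subrr.
  rewrite (gv nu) // mulr0 addr0; apply: (is_dl_meval_zero ab hE); first exact: gv.
  move=> _; apply: gv; first by rewrite (mdeg_inSn (inSn_sact _ _)).
  by apply: contra nmu' => /eqP E; rewrite /mu' -E sact_tpermK.
(* As g vanishes at the point of mu', only t x_a - x_b times the value of g at mu survives, and a
   zero factor would force mu'_a = mu'_b. *)
- rewrite mevalD mevalZ gmu' mulr0 addr0.
  have := is_dl_meval (sp mu') hE; rewrite gmu' mulr0 mulr0 !sub0r.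
  have nab' : mu' a != mu' b by rewrite !sact_tpermE tpermL tpermR eq_sym.
  rewrite -(meval_eq g (spoint_swap q t ab nab')) -/s mu'E mulrN opprK => E.
  apply/eqP => h0; move/eqP: E; rewrite h0 mulr0 eq_sym mulf_eq0 (negbTE gn) orbF.
  rewrite subr_eq0 => /eqP E; case/eqP: nab'.
  by apply: (spoint_eq qt_indep (e := 1)); rewrite expr1.
- have coef0 : g@_mu' = 0.
    apply/eqP/negP => /negP/(gsup _ deg'); case=> [E||[_]]; first by rewrite E eqxx in neq'.
      by rewrite nsq' ltnn.
    by rewrite inv'; lia.
  rewrite mcoeffD mcoeffZ coef0 mulr0 addr0 (is_dl_coef neq_ab hE); last first.
    by move=> m; apply: nsqg; rewrite ?deg' ?nsq'.
  by rewrite coef0 mulr0 add0r -/s mu'E g1 mulr1 /dl_swap lt ltnNge (ltnW lt).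
move=> tau; rewrite deg' => td.
(* When [normsq] is not smaller, x^tau receives contributions only from x^tau and its swap in g. *)
have [tn|tn _] := leqP (normsq mu) (normsq tau); last by apply: Or32; rewrite nsq'.
rewrite mcoeffD mcoeffZ (is_dl_coef neq_ab hE); last by move=> m; apply: nsqg.
have [gt|gt _] := eqVneq g@_tau 0; last first.
  have [->|h1|[h1 h2]] := gsup _ td gt; first by apply: Or33; split; rewrite ?inv' //;
    exact: inSn_sym (inSn_sact _ _).
    by lia.
  apply: Or33; split; last by lia.
  exact: inSn_trans (inSn_sym (inSn_sact _ _)) h1.
rewrite gt !mulr0 add0r addr0 mulf_eq0 negb_or -/s => /andP[_ gs].
have sd : mdeg (sact s tau) = mdeg mu by rewrite (mdeg_inSn (inSn_sact _ _)).
have [E|h1|[h1 h2]] := gsup _ sd gs.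
- by apply: Or31; rewrite /mu' -E sact_tpermK.
- by move: h1; rewrite (normsq_inSn (inSn_sact _ _)); lia.
apply: Or33; split; last by have := ninv_tperm_le tau ab; rewrite -/s; lia.
apply: inSn_trans (inSn_sym (inSn_sact _ _)) _.
exact: inSn_trans h1 (inSn_sym (inSn_sact _ _)).
Qed.

(** * Partitions, reached from lower degree by the cyclic shift *)

Lemma partition_support n (lambda : 'X_{1..n}) : is_partition lambda ->
  exists2 k, (k <= n)%N & forall i : 'I_n, (lambda i != 0%N) = (i < k)%N.
Proof.
move=> lP; pose P k := [forall i : 'I_n, (k <= i)%N ==> (lambda i == 0%N)].
have exP : exists k, P k.
  by exists n; apply/forallP => i; rewrite leqNgt ltn_ord.
case: (ex_minnP exP) => k Pk kmin; exists k.
  by apply: kmin; apply/forallP => i; rewrite leqNgt ltn_ord.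
move=> i; case: ltnP => [ik|ki]; last first.
  by move/forallP/(_ i): Pk; rewrite ki /= => /eqP->.
apply/eqP => l0; suff /kmin : P i by rewrite leqNgt ik.
apply/forallP => j; apply/implyP => ij; rewrite -leqn0 -l0; exact: lP.
Qed.

(** The count factors and depends on nu through [nsupp] alone, so it is constant on orbits. *)
Lemma zeros_nsupp n (nu : 'X_{1..n}) c :
  (\sum_(p : 'I_n * 'I_n) ((p.1 < c) && (nu p.2 != 0)) =
   (\sum_(i < n) (i < c)) * nsupp nu)%N.
Proof.
rewrite -(pair_bigA _ (fun i j : 'I_n => ((i < c) && (nu j != 0) : nat)%N)) /=.
rewrite big_distrl /=; apply: eq_bigr => i _; rewrite /nsupp.
by case: ltnP => _ /=; rewrite ?mul1n ?mul0n // big1.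
Qed.

(* Among the rearrangements supported on the positions [>= c], the one that
   decreases there has the fewest inversions. *)
Lemma ninv_shifted_partition n (eta nu : 'X_{1..n}) c : inSn eta nu ->
  (forall i : 'I_n, (i < c)%N -> eta i = 0%N) ->
  (forall i j : 'I_n, (c <= i)%N -> (i <= j)%N -> (eta j <= eta i)%N) ->
  (forall i : 'I_n, (i < c)%N -> nu i = 0%N) ->
  (ninv eta <= ninv nu)%N.
Proof.
move=> en e0 edec n0.
(* Count pairs of a position below c and a nonzero entry: all inversions of eta are such pairs, and
   for nu all such pairs are inversions. *)
apply: (@leq_trans (\sum_(p : 'I_n * 'I_n) ((p.1 < c) && (eta p.2 != 0)))%N).
  apply: leq_sum => -[i j] _ /=; case: (ltnP i c) => ic /=.
    by case: eqP => [->|_] /=; rewrite ?andbF // leq_b1.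
  case: (ltnP i j) => //= ij.
  by rewrite ltnNge edec // ltnW.
rewrite zeros_nsupp -(nsupp_inSn en) -zeros_nsupp; apply: leq_sum => -[i j] _ /=.
case: ltnP => //= ic; case: eqP => //= j0.
have cj : (c <= j)%N by rewrite leqNgt; apply/negP => /n0.
have jp : (0 < nu j)%N by rewrite lt0n; apply/eqP.
by rewrite (leq_trans ic cj) (n0 i ic) jp.
Qed.

Lemma Ebasis_partition m (lambda : 'X_{1..m.+1}) :
  (forall eta : 'X_{1..m.+1}, (mdeg eta < mdeg lambda)%N -> exists g, is_Ebasis eta g) ->
  is_partition lambda -> lambda != 0%MM -> exists g, is_Ebasis lambda g.
Proof.
move=> IH lP l0; have [k kn kE] := partition_support lP.
have k0 : (0 < k)%N.
  rewrite lt0n; apply: contra l0 => /eqP k0; apply/eqP/mnmP => i.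
  by apply/eqP; rewrite mnm0E -[_ == _]negbK kE k0.
pose eta : 'X_{1..m.+1} := [multinom
  if (i < m.+1 - k)%N then 0%N else (lambda (inord (i - (m.+1 - k)))).-1 | i < m.+1].
have eta_phi : iter k (@mphi m) eta = lambda.
  apply/mnmP => i; rewrite iter_mphiE // !mnmE.
  case: (ltnP i k) => ik; rewrite inordK; try (have := ltn_ord i; lia).
    rewrite ltnNge leq_addr /= addKn inord_val prednK // lt0n kE //.
  have -> : (i - k < m.+1 - k)%N by have := ltn_ord i; lia.
  by apply/esym/eqP; rewrite -[_ == _]negbK kE -leqNgt.
have deg_eta : mdeg lambda = (mdeg eta + k)%N by rewrite -eta_phi mdeg_iter_mphi.
have [|g [gI g1 gsup]] := IH eta; first by rewrite deg_eta; lia.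
(* The k entries that wrap around; among compositions of its degree, eta maximizes their sum. *)
pose tail (nu : 'X_{1..m.+1}) := (\sum_(i < m.+1 | m.+1 - k <= i) nu i)%N.
have deg_tail nu : mdeg nu = (tail nu + \sum_(i < m.+1 | ~~ (m.+1 - k <= i)) nu i)%N.
  by rewrite mdegE (bigID (fun i : 'I_m.+1 => m.+1 - k <= i)%N).
have eta0 (i : 'I_m.+1) : (i < m.+1 - k)%N -> eta i = 0%N by rewrite mnmE => ->.
have tail_eta : tail eta = mdeg eta.
  rewrite deg_tail [X in (_ + X)%N]big1 ?addn0 // => i.
  by rewrite -ltnNge; exact: eta0.
have nsq nu : normsq (iter k (@mphi m) nu) = (normsq nu + tail nu * 2 + k)%N.
  exact: normsq_iter_mphi.
have GI := iter_pphi_interpolates qt_indep k gI.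
have G0 := iter_pphi_coef qt_indep k gI.
have Gsup := fun tau => @iter_pphi_supp _ _ _ _ qt_indep k _ _ tau gI.
rewrite eta_phi in GI G0; move: GI G0 Gsup; rewrite g1 oner_eq0 => GI /(_ isT).
set G := iter k _ g in GI *; move=> G0 Gsup.
exists ((G@_lambda)^-1 *: G); case: GI => Gd Gv Gn; split.
- split.
  + by apply: leq_trans Gd; exact: mmeasureZ_le.
  + by move=> nu h1 h2; rewrite mevalZ Gv ?mulr0.
  + by rewrite mevalZ mulf_neq0 ?invr_eq0.
- by rewrite mcoeffZ mulVf.
move=> tau td; rewrite mcoeffZ mulf_eq0 negb_or => /andP[_ G1].
have [nu [nd -> gnu]] := Gsup _ (etrans td deg_eta) G1.
have [->|lt|[en lt]] := gsup _ nd gnu; first by rewrite eta_phi; exact: Or31.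
  apply: Or32; rewrite -eta_phi !nsq tail_eta -nd [mdeg nu]deg_tail; lia.
(* Here N(nu) = N(eta), so [tail] must drop. If nu were zero outside its tail, eta would have at
   most as many inversions as nu, a contradiction. *)
apply: Or32; rewrite -eta_phi !nsq tail_eta -nd (normsq_inSn en) [mdeg nu]deg_tail.
suff : (0 < \sum_(i < m.+1 | ~~ (m.+1 - k <= i)) nu i)%N by lia.
rewrite lt0n; apply/eqP => s0; suff : (ninv eta <= ninv nu)%N by lia.
apply: (ninv_shifted_partition en eta0) => [i j ci ij|i ic].
  rewrite !mnmE !ltnNge ci (leq_trans ci ij) /=.
  have : (lambda (inord (j - (m.+1 - k))) <= lambda (inord (i - (m.+1 - k))))%N.
    by apply: lP; rewrite !inordK; have := ltn_ord i; have := ltn_ord j; lia.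
  by lia.
move/eqP: s0; rewrite sum_nat_eq0 => /forallP/(_ i).
by rewrite -ltnNge ic /= => /eqP.
Qed.

Lemma Ebasis_zero n : is_Ebasis (0%MM : 'X_{1..n}) 1.
Proof.
split; last 2 first.
- by rewrite mcoeff1 eqxx.
- by move=> nu /eqP; rewrite mdeg0 mdeg_eq0 => /eqP-> _; exact: Or31.
split; rewrite ?msize1 ?meval1 ?oner_eq0 //.
by move=> nu; rewrite mdeg0 leqn0 mdeg_eq0 => ->.
Qed.

(** Strong induction on the degree; within a degree, swaps at descents lead from partitions to all
    compositions. *)
Lemma Ebasis_exists n (mu : 'X_{1..n}) : exists g, is_Ebasis mu g.
Proof.
have [d dE] : exists d, d = mdeg mu by eexists.
elim/ltn_ind: d mu dE => d IH mu /esym.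
elim/composition_ind: mu => [nu nP nd|a b nu ab lt IHnu].
  have [->|n0] := eqVneq nu 0%MM; first by exists 1; exact: Ebasis_zero.
  case: n IH nu nP nd n0 => [|m] IH nu nP nd n0.
    by case/eqP: n0; apply/mnmP; case.
  apply: Ebasis_partition => // eta; rewrite nd => ed.
  exact: IH ed _ erefl.
rewrite (mdeg_inSn (inSn_sact _ _)) => /IHnu[g gE].
exact: Ebasis_swap gE.
Qed.

End InterpolationBasis.

(** * Expansion and uniqueness *)

Section Expansion.
Variables (K : fieldType) (q t : K) (n : nat).
Hypothesis qt_indep : independent q t.
Local Notation sp := (spoint q t).
Implicit Types (mu nu tau lambda : 'X_{1..n}) (p f g : {mpoly K[n]}).

Definition Ebasis mu : {mpoly K[n]} := epsilon (inhabits 0) (is_Ebasis q t mu).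

Lemma EbasisP mu : is_Ebasis q t mu (Ebasis mu).
Proof. exact: epsilon_spec (Ebasis_exists qt_indep mu). Qed.

Definition Ecomb d (c : 'X_{1..n} -> K) : {mpoly K[n]} :=
  \sum_(m : 'X_{1..n < d.+1}) c m *: Ebasis m.

Lemma Ecomb_lin d a c c' :
  a *: Ecomb d c + Ecomb d c' = Ecomb d (fun m => a * c m + c' m).
Proof.
rewrite /Ecomb scaler_sumr -big_split /=; apply: eq_bigr => m _.
by rewrite scalerDl scalerA.
Qed.

Lemma Ecomb_sum d (r : seq 'X_{1..n}) (a : 'X_{1..n} -> K) (F : 'X_{1..n} -> {mpoly K[n]}) :
  (forall m, m \in r -> exists c, F m = Ecomb d c) ->
  exists c, \sum_(m <- r) a m *: F m = Ecomb d c.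
Proof.
elim: r => [|m r IH] H.
  by exists (fun=> 0); rewrite big_nil /Ecomb big1 // => m _; rewrite scale0r.
have [|c E] := IH; first by move=> m' h; apply: H; rewrite inE h orbT.
have [|c' E'] := H m; first by rewrite inE eqxx.
by eexists; rewrite big_cons E E' Ecomb_lin.
Qed.

(* The leading term of [Ebasis mu] for the order (degree, normsq, ninv) is x^mu. *)
Lemma monomial_Ecomb d mu : (mdeg mu <= d)%N -> exists c, 'X_[mu] = Ecomb d c.
Proof.
have [D] : exists D, D = mdeg mu by eexists.
elim/ltn_ind: D mu => D IHD mu; have [N] : exists N, N = normsq mu by eexists.
elim/ltn_ind: N mu => N IHN mu; have [I] : exists I, I = ninv mu by eexists.
elim/ltn_ind: I mu => I IHI mu EI EN ED mud.
have [[gd _ _] g1 gsup] := EbasisP mu.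
have mu_in : mu \in msupp (Ebasis mu) by rewrite mcoeff_msupp g1 oner_eq0.
(* The monomials of E_mu other than x^mu are smaller, so induction expands them. *)
have [|c' E'] := @Ecomb_sum d (rem mu (msupp (Ebasis mu)))
    (fun m => (Ebasis mu)@_m) (fun m => 'X_[m]).
  move=> nu; rewrite mem_rem_uniq ?msupp_uniq // inE => /andP[nmu].
  rewrite mcoeff_msupp => gnu; have := proj1 (msize_leP _ _) gd _ gnu.
  rewrite leq_eqVlt => /orP[/eqP nd|nd]; last first.
    by apply: (IHD (mdeg nu)) => //; rewrite ?ED //; exact: leq_trans (ltnW nd) mud.
  have nd' : mdeg nu = D by rewrite ED.
  have nd'' : (mdeg nu <= d)%N by rewrite nd.
  have [E|h|[h1 h2]] := gsup _ nd gnu; first by rewrite E eqxx in nmu.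
    by apply: (IHN (normsq nu)) => //; rewrite EN.
  apply: (IHI (ninv nu)) => //; rewrite ?EI // EN; exact/esym/normsq_inSn.
have [c EE] : exists c, Ebasis mu = Ecomb d c.
  have mub : (mdeg mu < d.+1)%N by [].
  exists (fun m => (m == mu)%:R); rewrite /Ecomb (bigD1 (BMultinom mub)) //= eqxx.
  rewrite scale1r big1 ?addr0 // => m h.
  by move: h; rewrite -val_eqE /= => /negbTE->; rewrite scale0r.
exists (fun m => -1 * c' m + c m); rewrite -Ecomb_lin -E' -EE scaleN1r addrC.
rewrite [X in X - _]mpolyE (big_rem mu) //= g1 scale1r.
by rewrite -addrA subrr addr0.
Qed.

Lemma Ecomb_exists d p : (msize p <= d.+1)%N -> exists c, p = Ecomb d c.
Proof.
move=> /msize_leP pd; rewrite [p]mpolyE; apply: Ecomb_sum => m.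
by rewrite mcoeff_msupp => /pd; exact: monomial_Ecomb.
Qed.

(** Induct on the degree of nu. At its point E_m vanishes for every other m of no smaller degree; an
    m of smaller degree lies outside S, which lives in degree d, so its coefficient is already 0. *)
Lemma Ecomb_vanish d c (S : 'X_{1..n} -> Prop) :
  (forall nu, S nu -> mdeg nu = d) ->
  (forall nu, (mdeg nu <= d)%N -> ~ S nu -> (Ecomb d c).@[sp nu] = 0) ->
  forall nu, (mdeg nu <= d)%N -> ~ S nu -> c nu = 0.
Proof.
move=> Sd H nu; have [D] : exists D, D = mdeg nu by eexists.
elim/ltn_ind: D nu => D IH nu ED nd nS.
have [[_ _ gn] _ _] := EbasisP nu.
have nb : (mdeg nu < d.+1)%N by [].
have := H nu nd nS; rewrite /Ecomb rmorph_sum (bigD1 (BMultinom nb)) //= mevalZ.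
rewrite big1 ?addr0 => [/eqP|m]; first by rewrite mulf_eq0 (negbTE gn) orbF => /eqP.
rewrite -val_eqE /= mevalZ => mnu; have [[_ gv _] _ _] := EbasisP m.
have [le|lt] := leqP (mdeg nu) (mdeg m).
  by rewrite gv ?mulr0 // eq_sym.
rewrite (IH (mdeg m)) ?mul0r //; first by rewrite ED.
  exact: leq_trans (ltnW lt) nd.
by move/Sd => md; move: lt; rewrite md ltnNge nd.
Qed.

Lemma Ebasis_unique mu g : (msize g <= (mdeg mu).+1)%N -> g@_mu = 1 ->
  (forall nu, (mdeg nu <= mdeg mu)%N -> nu <> mu -> g.@[sp nu] = 0) ->
  g = Ebasis mu.
Proof.
move=> /Ecomb_exists[c E] + H; rewrite {1}E.
have c0 : forall nu, (mdeg nu <= mdeg mu)%N -> nu <> mu -> c nu = 0.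
  apply: (@Ecomb_vanish _ _ (fun nu => nu = mu)) => [nu -> //|nu h1 h2].
  by rewrite -E; exact: H.
have mub : (mdeg mu < (mdeg mu).+1)%N by [].
have cE : Ecomb (mdeg mu) c = c mu *: Ebasis mu.
  rewrite /Ecomb (bigD1 (BMultinom mub)) //= big1 ?addr0 // => m.
  rewrite -val_eqE /= => /eqP h; rewrite c0 ?scale0r //.
  by rewrite -ltnS; exact: bmdeg.
have [_ g1 _] := EbasisP mu.
by rewrite cE mcoeffZ g1 mulr1 => c1; rewrite E cE c1 scale1r.
Qed.

(** By the vanishing, p is a combination of the E_tau with tau in the orbit, and their orbit
    coefficients are unitriangular for [ninv]. *)
Lemma orbit_coef_inj lambda p : (msize p <= (mdeg lambda).+1)%N ->
  (forall nu, (mdeg nu <= mdeg lambda)%N -> ~ inSn lambda nu -> p.@[sp nu] = 0) ->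
  (forall tau, inSn lambda tau -> p@_tau = 0) -> p = 0.
Proof.
move=> /Ecomb_exists[c E] Hv Hc.
have c0 : forall nu, (mdeg nu <= mdeg lambda)%N -> ~ inSn lambda nu -> c nu = 0.
  apply: Ecomb_vanish => [nu /mdeg_inSn //|nu h1 h2].
  by rewrite -E; exact: Hv.
have [/existsP[m0 cm0]|/existsPn allz] :=
    boolP [exists m : 'X_{1..n < (mdeg lambda).+1}, c m != 0]; last first.
  rewrite E /Ecomb big1 // => m _.
  by move: (allz m); rewrite negbK => /eqP->; rewrite scale0r.
(* With [ninv] maximal at m, no other E_k with nonzero coefficient contains x^m. *)
case: (@arg_maxnP _ m0 (fun m => c (bmnm m) != 0) (fun m => ninv m) cm0) => m cm mmax.
have orb (k : 'X_{1..n < (mdeg lambda).+1}) : c k != 0 -> inSn lambda k.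
  move=> ck; apply: NNPP => h; case/eqP: ck; apply: c0 => //.
  by rewrite -ltnS; exact: bmdeg.
have := Hc m (orb _ cm); rewrite E /Ecomb raddf_sum (bigD1 m) //= mcoeffZ.
have [_ -> _] := EbasisP m; rewrite mulr1 big1 ?addr0 => [c0'|k km].
  by rewrite c0' eqxx in cm.
rewrite mcoeffZ; have [->|ck] := eqVneq (c k) 0; first by rewrite mul0r.
have [_ _ gsup] := EbasisP k.
have [->|gk] := eqVneq (Ebasis k)@_m 0; first by rewrite mulr0.
have mk := inSn_trans (inSn_sym (orb _ ck)) (orb _ cm).
have [/val_inj Ek|h|[_ h]] := gsup m (mdeg_inSn mk) gk.
- by rewrite Ek eqxx in km.
- by rewrite (normsq_inSn mk) ltnn in h.
by have : (ninv k <= ninv m)%N := mmax k ck; rewrite leqNgt h.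
Qed.

(** The conditions of the theorem, plus a bound on [normsq] in top degree that makes the coefficient
    formula for T_i available on the orbit. *)
Definition orbit_delta lambda mu f : Prop :=
  [/\ (msize f <= (mdeg lambda).+1)%N,
      forall nu, (mdeg nu <= mdeg lambda)%N -> ~ inSn lambda nu -> f.@[sp nu] = 0,
      forall tau, inSn lambda tau -> f@_tau = (tau == mu)%:R &
      forall nu, mdeg nu = mdeg lambda -> f@_nu != 0 ->
        (normsq nu <= normsq lambda)%N].

(** A partition has no inversions, so triangularity admits no other rearrangement. *)
Lemma orbit_delta_Ebasis lambda : is_partition lambda ->
  orbit_delta lambda lambda (Ebasis lambda).
Proof.
move=> lP; have [[gd gv _] g1 gsup] := EbasisP lambda; split=> //.
- move=> nu nd no; apply: gv => //; apply/eqP => E; apply: no; rewrite E.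
  exact: inSn_refl.
- move=> tau to; have [->|nt] := eqVneq tau lambda; first by [].
  apply/eqP/negP => /negP/(gsup _ (mdeg_inSn to)); case=> [E|h|[_]].
  + by rewrite E eqxx in nt.
  + by rewrite (normsq_inSn to) ltnn in h.
  by rewrite (ninv_partition lP).
by move=> nu nd /(gsup _ nd)[->|/ltnW|[/normsq_inSn-> _]].
Qed.

Lemma orbit_delta_swap lambda mu (a b : 'I_n) f g :
  b = a.+1 :> nat -> (mu b < mu a)%N -> is_dl t a b f g ->
  orbit_delta lambda mu f -> orbit_delta lambda (sact (tperm a b) mu) g.
Proof.
move=> ab lt fg [fd fv fo fN]; set s := tperm a b.
have neq_ab : a != b by rewrite -val_eqE /= ab; lia.
have coefE tau : mdeg tau = mdeg lambda -> (normsq lambda <= normsq tau)%N ->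
    g@_tau = dl_diag t a b tau * f@_tau + dl_swap t a b (sact s tau) * f@_(sact s tau).
  move=> td tn; apply: is_dl_coef => // m fm md.
  by apply: leq_trans tn; apply: fN => //; rewrite md.
split.
- exact: is_dl_msize fg fd.
- move=> nu nd no; apply: (is_dl_meval_zero qt_indep ab fg); first exact: fv.
  move=> _; apply: fv; first by rewrite (mdeg_inSn (inSn_sact _ _)).
  by move=> h; apply: no; exact: inSn_trans h (inSn_sym (inSn_sact _ _)).
- move=> tau to; have so : inSn lambda (sact s tau) by exact: inSn_trans to (inSn_sact _ _).
  rewrite coefE ?(mdeg_inSn to) ?(normsq_inSn to) // !fo //.
  have -> : (sact s tau == mu) = (tau == sact s mu).
    by apply/eqP/eqP => [<-|->]; rewrite sact_tpermK.
  (* As mu has a strict descent, s mu receives [dl_swap] of mu, which is 1, and mu receives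
     [dl_diag] of mu, which is 0. *)
  have [->|tm] := eqVneq tau (sact s mu).
    rewrite sact_tpermK /dl_swap lt ltnNge (ltnW lt) /= mulr1.
    have [E|_] := eqVneq (sact s mu) mu; last by rewrite mulr0 add0r.
    have := congr1 (fun m : 'X_{1..n} => m a) E; rewrite sact_tpermE tpermL => E'.
    by rewrite E' ltnn in lt.
  rewrite mulr0 addr0; have [->|_] := eqVneq tau mu; last by rewrite mulr0.
  by rewrite /dl_diag lt ltnNge (ltnW lt) mul0r.
move=> nu nd; rewrite leqNgt; apply: contra => lt'.
rewrite coefE // ?(ltnW lt') //.
have z tau : mdeg tau = mdeg lambda -> normsq tau = normsq nu -> f@_tau = 0.
  by move=> td tn; apply/eqP/negP => /negP/(fN _ td); rewrite tn leqNgt lt'.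
rewrite !z ?(mdeg_inSn (inSn_sact s nu)) ?(normsq_inSn (inSn_sact s nu)) //.
by rewrite !mulr0 addr0.
Qed.

End Expansion.

(** * Reduced words *)

Section ReducedWords.
Variable n : nat.
Implicit Types (s : 'S_n) (w : seq nat) (lambda mu : 'X_{1..n}).

Lemma valid_idxP i : valid_idx n i ->
  exists a b : 'I_n, [/\ b = a.+1 :> nat, sperm n i = tperm a b &
    forall f, Ti i f = Tab a b f].
Proof.
move=> h; exists (Ordinal (ltnW h)), (Ordinal h); rewrite /sperm /Ti.
case: {-}_ / idP => [h'|/(_ h) //]; rewrite (bool_irrelevance h' h).
by split.
Qed.

Lemma sperm_adj (a b : 'I_n) : b = a.+1 :> nat ->
  valid_idx n a /\ sperm n a = tperm a b.
Proof.
move=> ab; have h : (a.+1 < n)%N by rewrite -ab.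
split=> //; rewrite /sperm; case: {-}_ / idP => [h'|/(_ h) //].
by congr tperm; apply: val_inj.
Qed.

Lemma sact_wperm_cons i w lambda :
  sact (wperm n (i :: w)) lambda = sact (sperm n i) (sact (wperm n w) lambda).
Proof. by rewrite /= sactM. Qed.

(** Each swap at a descent adds one letter and one inversion. *)
Lemma word_to lambda mu : is_partition lambda -> inSn lambda mu ->
  exists w, [/\ all (@valid_idx n) w, sact (wperm n w) lambda = mu & size w = ninv mu].
Proof.
move=> lP; elim/composition_ind: mu => [mu mP lm|a b mu ab lt IH lm].
  exists [::]; rewrite (ninv_partition mP) /= sact1; split=> //.
  exact/esym/inSn_partition_unique.
have [w [wv wE ws]] := IH (inSn_trans lm (inSn_sym (inSn_sact _ _))).
have [av aE] := sperm_adj ab.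
exists (nat_of_ord a :: w); rewrite /= av wv sactM wE aE ws; split=> //.
by have := ninv_swap mu ab; rewrite lt ltnNge (ltnW lt) /=; lia.
Qed.

Lemma wperm_surj s : exists2 w, all (@valid_idx n) w & wperm n w = s.
Proof.
(* rho = (n, ..., 1) has distinct entries, so a permutation is determined by its action on it. *)
pose rho : 'X_{1..n} := [multinom (n - i)%N | i < n].
have rhoP : is_partition rho by move=> i j ij; rewrite !mnmE; lia.
have [w [wv /mnmP wE _]] := word_to rhoP (inSn_sact s rho).
exists w => //; apply: invg_inj; apply/permP => i; apply: val_inj.
have := wE i; rewrite !sactE !mnmE.
move: ((wperm n w)^-1 i)%g (s^-1 i)%g => x y.
by have := ltn_ord x; have := ltn_ord y; rewrite /=; lia.
Qed.

Lemma ninv_wperm w lambda : is_partition lambda -> all (@valid_idx n) w ->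
  (ninv (sact (wperm n w) lambda) <= size w)%N.
Proof.
move=> lP; elim: w => [|i w IH]; first by rewrite sact1 (ninv_partition lP).
rewrite sact_wperm_cons => /= /andP[/valid_idxP[a [b [ab -> _]]] /IH h].
have := ninv_tperm_le (sact (tperm a b) (sact (wperm n w) lambda)) ab.
rewrite sact_tpermK; lia.
Qed.

Lemma exists_min (P : nat -> Prop) : (exists k, P k) ->
  exists2 k, P k & forall l, P l -> (k <= l)%N.
Proof.
case=> k; elim/ltn_ind: k => k IH Pk.
have [[l lk Pl]|H] := classic (exists2 l, (l < k)%N & P l); first exact: IH Pl.
by exists k => // l Pl; rewrite leqNgt; apply/negP => lk; apply: H; exists l.
Qed.

Lemma plenP s :
  (exists w, all (@valid_idx n) w /\ wperm n w = s /\ size w = plen s) /\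
  forall w, all (@valid_idx n) w -> wperm n w = s -> (plen s <= size w)%N.
Proof.
apply: (epsilon_spec (inhabits 0%N) (fun l =>
  (exists w, all (@valid_idx n) w /\ wperm n w = s /\ size w = l) /\
  forall w, all (@valid_idx n) w -> wperm n w = s -> (l <= size w)%N)).
have [|l [w wl] lmin] := @exists_min (fun l =>
    exists w, all (@valid_idx n) w /\ wperm n w = s /\ size w = l).
  by have [w wv wE] := wperm_surj s; exists (size w), w.
by exists l; split; [exists w | move=> w' h1 h2; apply: lmin; exists w'].
Qed.

Lemma reduced_word_size s :
  let w := epsilon (inhabits [::]) (reduced_word s) in
  [/\ all (@valid_idx n) w, wperm n w = s & (size w <= plen s)%N].
Proof.
have [[w0 [h1 [h2 h3]]] pmin] := plenP s.
have [|h4 h5 h6] := epsilon_spec (inhabits [::]) (reduced_word s).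
  by exists w0; split=> // w' h h'; rewrite h3; exact: pmin.
by split=> //; rewrite -h3; exact: h6.
Qed.

Lemma sigma_ofP lambda mu : inSn lambda mu ->
  sact (sigma_of lambda mu) lambda = mu /\
  forall s, sact s lambda = mu -> (plen (sigma_of lambda mu) <= plen s)%N.
Proof.
case=> s0 E0; apply: (epsilon_spec (inhabits 1%g) (fun s =>
  sact s lambda = mu /\ forall s', sact s' lambda = mu -> (plen s <= plen s')%N)).
have [|l [s [sE sl]] lmin] := @exists_min (fun l =>
    exists s, sact s lambda = mu /\ plen s = l); first by exists (plen s0), s0.
by exists s; split=> // s' h; rewrite sl; apply: lmin; exists s'.
Qed.

Lemma Tab_is_dl (a b : 'I_n) f : a != b -> is_dl tt a b f (Tab a b f).
Proof.
move=> ab; apply: (epsilon_spec (inhabits 0)).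
by have [g [gE _ _]] := dl_exists tt ab f; exists g.
Qed.

(* A word no longer than the number of inversions it creates makes each of its
   letters act at a strict descent. *)
Lemma orbit_delta_word lambda w f : is_partition lambda ->
  orbit_delta qq tt lambda lambda f ->
  all (@valid_idx n) w -> (size w <= ninv (sact (wperm n w) lambda))%N ->
  orbit_delta qq tt lambda (sact (wperm n w) lambda)
    (foldr (fun i g => Ti i g) f w).
Proof.
move=> lP fE; elim: w => [|i w IH]; first by rewrite sact1.
rewrite sact_wperm_cons /= => /andP[iv wv] sz.
have [a [b [ab iE TE]]] := valid_idxP iv; rewrite iE in sz *; rewrite TE.
have le := ninv_wperm lP wv; have sw := ninv_swap (sact (wperm n w) lambda) ab.
have neq_ab : a != b by rewrite -val_eqE /= ab; lia.
(* The rest of the word creates at most [size w] inversions, so this letter must add one, which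
   happens only at a strict descent. *)
have lt : (sact (wperm n w) lambda b < sact (wperm n w) lambda a)%N.
  by move: sw; case: ltnP; case: ltnP; lia.
have sz' : (size w <= ninv (sact (wperm n w) lambda))%N.
  by move: sw; case: ltnP; case: ltnP; lia.
exact: (orbit_delta_swap qq_tt_independent ab lt (Tab_is_dl _ neq_ab) (IH wv sz')).
Qed.

Lemma Estar_Ebasis mu : Estar mu = Ebasis qq tt mu.
Proof.
have [|gd g1 gv] := epsilon_spec (inhabits 0) (Estar_spec mu).
  have [[h1 h2 _] h3 _] := EbasisP qq_tt_independent mu.
  exists (Ebasis qq tt mu); split=> // nu nd /eqP nm; exact: h2.
exact: (Ebasis_unique qq_tt_independent).
Qed.

Lemma orbit_delta_fstar lambda mu : is_partition lambda -> inSn lambda mu ->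
  orbit_delta qq tt lambda mu (fstar lambda mu).
Proof.
move=> lP lm; have [sE smin] := sigma_ofP lm.
have [wv wE wsz] := reduced_word_size (sigma_of lambda mu).
have [w0 [w0v w0E w0s]] := word_to lP lm.
rewrite /fstar /Tperm; set w := epsilon _ _ in wv wE wsz *.
rewrite -{1}sE -wE; apply: orbit_delta_word => //.
  by rewrite Estar_Ebasis; exact: orbit_delta_Ebasis qq_tt_independent _ lP.
(* Minimality of sigma_mu against the word [w0] of length inv(mu) bounds the length of the reduced
   word. *)
rewrite wE sE -w0s; apply: leq_trans wsz (leq_trans (smin _ w0E) _).
by have [_ pmin] := plenP (wperm n w0); exact: pmin.
Qed.

End ReducedWords.

Theorem theorem2p17 (n : nat) (lambda mu : 'X_{1..n}) :
  is_partition lambda -> inSn lambda mu ->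
  forall g : {mpoly Kqt[n]},
    [/\ (msize g <= (mdeg mu).+1)%N,
        (forall nu : 'X_{1..n}, (mdeg nu <= mdeg mu)%N -> ~ inSn lambda nu ->
           g.@[tilde nu] = 0) &
        (forall tau : 'X_{1..n}, inSn lambda tau ->
           g@_tau = (if tau == mu then 1 else 0))]
    <-> g = fstar lambda mu.
Proof.
move=> lP lm g; rewrite (mdeg_inSn lm).
have [fd fv fo _] := orbit_delta_fstar lP lm.
split=> [[gd gv go]|->]; last first.
  by split=> // tau to; rewrite fo //; case: eqP.
(* The difference of two solutions vanishes off the orbit up to degree |mu| and has zero orbit
   coefficients. *)
apply/eqP; rewrite -subr_eq0; apply/eqP.
apply: (orbit_coef_inj qq_tt_independent (lambda := lambda)).
- apply/msize_leP => nu; rewrite mcoeffB.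
  have [h|/(proj1 (msize_leP _ _) gd) //] := eqVneq g@_nu 0.
  rewrite h sub0r oppr_eq0; exact: (proj1 (msize_leP _ _) fd).
- by move=> nu nd no; rewrite mevalB gv // fv // subrr.
by move=> tau to; rewrite mcoeffB go // fo //; case: eqP => _; rewrite subrr.
Qed.
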